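(* Let $g$ be the generalized identity function $$g(t)=\int_0^1\frac{(tz)^{\alpha(0)-\alpha(tz)}}{\Gamma(\alpha(0)-1)\,\Gamma(2-\alpha(tz))}(1-z)^{\alpha(0)-2}z^{1-\alpha(0)}\,dz .$$ If $\alpha'(0)=0$, then there is a constant $Q>0$ such that $|g'(t)|\le Q$ for $t\in[0,T]$ and $|g''(t)|\le Q(|\ln t|+1)$ for $t\in(0,T]$.
   Context: $T>0$ is fixed. The variable exponent $\alpha:[0,T]\to(1,2)$ is three times differentiable with $|\alpha'(t)|+|\alpha''(t)|+|\alpha'''(t)|$ bounded on $[0,T]$. The function $g$ arises as the convolution $g=\beta_{\alpha_0-1}*k$, where $\alpha_0=\alpha(0)$, $\beta_\mu(t)=t^{\mu-1}/\Gamma(\mu)$, $k(t)=t^{1-\alpha(t)}/\Gamma(2-\alpha(t))$ and $(v*w)(t)=\int_0^t v(t-s)w(s)\,ds$; it satisfies $g(0)=1$ (value understood as the limit $t\to0^+$). $Q$ may depend on $\alpha$ and $T$ but not on $t$. *)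

(* Defs.v *)
From HB Require Import structures.
From mathcomp Require Import all_boot all_order all_algebra.
From mathcomp Require Import all_classical all_reals all_analysis.

Set Implicit Arguments.
Unset Strict Implicit.
Unset Printing Implicit Defensive.

Import Order.TTheory GRing.Theory Num.Theory.
Import numFieldNormedType.Exports.

Local Open Scope classical_set_scope.
Local Open Scope ring_scope.

(* Only meaningful for x > 0. *)
Definition Gamma (R : realType) (x : R) : R :=
  Rintegral (@lebesgue_measure R) `]0, +oo[%classic
    (fun s => s `^ (x - 1) * expR (- s)).

(* Derivative relative to a set D: only the values of f on D matter at points
   of D, so for D = `[a, b] it is one-sided at a and at b.  As a limit, it is
   unique when x is an accumulation point of D. *)
Definition diff_quot (R : realType) (f : R -> R) (x y : R) : R :=
  (f y - f x) / (y - x).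

Definition derivable_in (R : realType) (D : set R) (f : R -> R) (x : R) : Prop :=
  cvg (diff_quot f x y @[y --> within D x^']).

Definition derive_in (R : realType) (D : set R) (f : R -> R) (x : R) : R :=
  lim (diff_quot f x y @[y --> within D x^']).

Definition derive_in_n (R : realType) (D : set R) (n : nat) (f : R -> R) :
  R -> R := iter n (derive_in D) f.

(* At t = 0 the convention 0 `^ 0 = 1 turns the integrand into
   (1 - z)^(alpha 0 - 2) z^(1 - alpha 0) / (Gamma (alpha 0 - 1) Gamma (2 - alpha 0)),
   whose integral is the limit value g(0+) = 1 (Euler's Beta integral). *)
Definition gen_identity (R : realType) (alpha : R -> R) (t : R) : R :=
  Rintegral (@lebesgue_measure R) `[0, 1]%classic
    (fun z => (t * z) `^ (alpha 0 - alpha (t * z))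
              / (Gamma (alpha 0 - 1) * Gamma (2 - alpha (t * z)))
              * (1 - z) `^ (alpha 0 - 2) * z `^ (1 - alpha 0)).

(* Main.v *)
Require Import Defs.
From HB Require Import structures.
From mathcomp Require Import all_boot all_order all_algebra.
From mathcomp Require Import all_classical all_reals all_analysis.
From mathcomp Require Import measurable_realfun ring lra.
Import Order.TTheory GRing.Theory Num.Theory.
Import numFieldNormedType.Exports.
Local Open Scope classical_set_scope.
Local Open Scope ring_scope.

(** Write u(s) = alpha(0) - alpha(s),
    h(s) = s^u(s) / (Gamma(alpha(0) - 1) Gamma(2 - alpha(s))) and
    w(z) = (1 - z)^(alpha(0) - 2) z^(1 - alpha(0)), so that
    g(t) = int_0^1 h(t z) w(z) dz with w integrable.  As alpha'(0) = 0, u is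
    O(s^2) and u' is O(s); hence u ln s, which vanishes at 0 together with its
    derivative u' ln s + u / s, is C^1 up to 0, h' is bounded, and the only
    unbounded term of h'' comes from u'' ln s, so h'' = O(|ln s| + 1).
    Dominated convergence then gives g'(t) = int z h'(t z) w(z) dz on [0, T] and
    g''(t) = int z^2 h''(t z) w(z) dz for t > 0, and z |ln z| <= 1 + z^2 turns
    |ln (t z)| into |ln t| + O(1).  All derivatives are taken within [0, T]. *)

(** * Derivatives relative to a set *)

Definition has_derive_in {R : realType} (D : set R) (f : R -> R) (x l : R) :=
  diff_quot f x y @[y --> within D x^'] --> l.

Section derivative_within.
Context {R : realType} (D : set R).
Implicit Types (f g F : R -> R) (x l : R).

Lemma within_dnbhs_cvg x : within D x^' --> x.
Proof. by apply: cvg_trans; apply: cvg_within. Qed.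

Lemma has_derive_inD f g x l k : has_derive_in D f x l ->
  has_derive_in D g x k -> has_derive_in D (fun y => f y + g y) x (l + k).
Proof.
rewrite /has_derive_in => fl gk.
rewrite (_ : diff_quot _ x = diff_quot f x \+ diff_quot g x); first exact: cvgD.
by apply/funext => y; rewrite /diff_quot /= -mulrDl opprD addrACA.
Qed.

Lemma has_derive_in_cst x c : has_derive_in D (fun=> c) x 0.
Proof.
rewrite /has_derive_in (_ : diff_quot _ x = cst 0); first exact: cvg_cst.
by apply/funext => y; rewrite /diff_quot subrr mul0r.
Qed.

Lemma has_derive_in_continuous f x l : has_derive_in D f x l ->
  f y @[y --> within D x^'] --> f x.
Proof.
move=> fl.
have sub0 : (y - x) @[y --> within D x^'] --> (0 : R).
  by rewrite -(subrr x); apply: cvgB; [exact: within_dnbhs_cvg|exact: cvg_cst].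
have : (f x + diff_quot f x y * (y - x)) @[y --> within D x^'] --> f x + l * 0.
  by apply: cvgD; [exact: cvg_cst|exact: cvgM].
rewrite mulr0 addr0; apply: cvg_trans; apply: near_eq_cvg.
rewrite near_withinE near_withinE; apply/nearW => y /= yx _.
by rewrite /diff_quot divfK ?subr_eq0// addrC subrK.
Qed.

Lemma has_derive_inM f g x l k : has_derive_in D f x l ->
  has_derive_in D g x k ->
  has_derive_in D (fun y => f y * g y) x (l * g x + f x * k).
Proof.
move=> fl gk; have gx := has_derive_in_continuous _ _ _ gk.
have : (diff_quot f x y * g y + f x * diff_quot g x y)
    @[y --> within D x^'] --> l * g x + f x * k.
  by apply: cvgD; apply: cvgM => //; exact: cvg_cst.
apply: cvg_trans; apply: near_eq_cvg; apply/nearW => y /=.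
by rewrite /diff_quot /=; ring.
Qed.

Lemma has_derive_inZ c f x l : has_derive_in D f x l ->
  has_derive_in D (fun y => c * f y) x (c * l).
Proof.
move=> fl; have := has_derive_inM _ _ _ _ _ (has_derive_in_cst x c) fl.
by rewrite mul0r add0r.
Qed.

Lemma has_derive_in_comp F f x l k : is_derive (f x) 1 F k ->
  has_derive_in D f x l -> has_derive_in D (F \o f) x (k * l).
Proof.
move=> /is_derive1_caratheodory[c [Fc cc <-]] fl.
have : c (f y) * diff_quot f x y @[y --> within D x^'] --> c (f x) * l.
  apply: cvgM => //.
  exact: (cvg_comp _ _ (has_derive_in_continuous _ _ _ fl) cc).
apply: cvg_trans; apply: near_eq_cvg; apply/nearW => y /=.
by rewrite /diff_quot /= Fc mulrA.
Qed.

Lemma is_derive_has_derive_in f x l : is_derive x 1 f l ->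
  has_derive_in D f x l.
Proof.
move=> /is_derive1_caratheodory[c [fc cc <-]].
have : c y @[y --> within D x^'] --> c x.
  exact: (cvg_comp _ _ (within_dnbhs_cvg x) cc).
apply: cvg_trans; apply: near_eq_cvg.
rewrite near_withinE near_withinE; apply/nearW => y /= yx _.
by rewrite /diff_quot fc mulfK// subr_eq0.
Qed.

Lemma has_derive_in_is_derive f x l : nbhs x D -> has_derive_in D f x l ->
  is_derive x 1 f l.
Proof.
move=> Dx fl; apply/is_derive1_caratheodory.
exists (fun y => if y == x then l else diff_quot f x y); split; last 2 first.
- apply/cvgrPdist_lt => e e0; rewrite eqxx.
  move/cvgrPdist_lt : fl => /(_ _ e0).
  rewrite near_withinE near_withinE => fl; near=> y.
  have [_|yx] := eqVneq; first by rewrite subrr normr0.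
  have Dy : D y by near: y.
  by move: yx Dy; near: y.
- by rewrite eqxx.
- move=> y; have [->|yx] := eqVneq; first by rewrite !subrr mulr0.
  by rewrite /diff_quot divfK// subr_eq0.
Unshelve. all: by end_near. Qed.

Lemma eq_has_derive_in f g x l : D x -> {in D, f =1 g} ->
  has_derive_in D f x l -> has_derive_in D g x l.
Proof.
move=> Dx fg; apply: cvg_trans; apply: near_eq_cvg.
rewrite near_withinE; apply/nearW => y Dy /=.
by rewrite /diff_quot !fg ?inE.
Qed.

Lemma cvg_within_dnbhs_seq f x l :
  (forall u : R^nat, (forall n, D (u n) /\ u n != x) -> u n @[n --> \oo] --> x ->
     f (u n) @[n --> \oo] --> l) ->
  f y @[y --> within D x^'] --> l.
Proof.
move=> fu; apply: contrapT => nfl.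
have {nfl}[e e0 nfl] : exists2 e, 0 < e & forall d, 0 < d ->
    exists y, [/\ `|x - y| < d, D y, y != x & ~ `|l - f y| < e].
  apply: contrapT => H; apply: nfl; apply/cvgrPdist_lt => e e0.
  rewrite near_withinE near_withinE; apply: contrapT => nH.
  apply: H; exists e => // d d0; apply: contrapT => nd; apply: nH.
  apply/nbhs_ballP; exists d => //= y xy yx Dy.
  by apply: contrapT => nle; apply: nd; exists y.
have /choice[u up] : forall n : nat, exists y,
    [/\ `|x - y| < n.+1%:R^-1, D y, y != x & ~ `|l - f y| < e].
  by move=> n; apply: nfl; rewrite invr_gt0.
have ux : u n @[n --> \oo] --> x.
  apply/cvgrPdist_lt => d d0; near=> n.
  have [+ _ _ _] := up n; move/lt_trans; apply.
  by near: n; exact: near_infty_natSinv_lt (PosNum d0).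
have Du n : D (u n) /\ u n != x by have [] := up n.
have /cvgrPdist_lt/(_ _ e0)[N _ /(_ N (leqnn N))/=] := fu u Du ux.
by have [] := up N.
Unshelve. all: by end_near. Qed.

End derivative_within.

Lemma within_itvcc_proper {R : realType} (a b x : R) : a < b -> a <= x <= b ->
  ProperFilter (within `[a, b]%classic x^').
Proof.
move=> ab /andP[ax xb]; apply: Build_ProperFilter_ex => P.
rewrite /within /= => /nbhs_ballP[e /= e0 eP].
suff [y [xy yx aby]] : exists y, [/\ `|x - y| < e, y != x & `[a, b]%classic y].
  by exists y; exact: eP xy yx aby.
have [xlb|bx] := ltP x b.
  have m0 : 0 < Num.min (e / 2) (b - x) by rewrite lt_min !subr_gt0 divr_gt0.
  have me : Num.min (e / 2) (b - x) <= e / 2 by rewrite ge_min lexx.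
  have mb : Num.min (e / 2) (b - x) <= b - x by rewrite ge_min lexx orbT.
  move: (Num.min _ _) m0 me mb => m m0 me mb.
  exists (x + m); split.
  - by rewrite opprD addNKr normrN gtr0_norm//; lra.
  - by apply/eqP; lra.
  - by rewrite /= in_itv/=; apply/andP; split; lra.
have m0 : 0 < Num.min (e / 2) (b - a) by rewrite lt_min !subr_gt0 divr_gt0.
have me : Num.min (e / 2) (b - a) <= e / 2 by rewrite ge_min lexx.
have mb : Num.min (e / 2) (b - a) <= b - a by rewrite ge_min lexx orbT.
move: (Num.min _ _) m0 me mb => m m0 me mb.
exists (x - m); split.
- by rewrite opprB addrC subrK gtr0_norm//; lra.
- by apply/eqP; lra.
- by rewrite /= in_itv/=; apply/andP; split; lra.
Qed.

Lemma has_derive_inE {R : realType} (a b x l : R) (f : R -> R) : a < b ->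
  a <= x <= b -> has_derive_in `[a, b]%classic f x l ->
  derivable_in `[a, b]%classic f x /\ derive_in `[a, b]%classic f x = l.
Proof.
move=> ab axb fl; have PF := within_itvcc_proper _ _ _ ab axb.
by split; [apply/cvg_ex; exists l|exact/cvg_lim].
Qed.

(** * Differentiation under the integral sign within a set *)

Lemma within_dnbhs_seq {R : realType} (D : set R) (x : R) :
  ProperFilter (within D x^') ->
  exists u : R^nat, (forall n, D (u n) /\ u n != x) /\ u n @[n --> \oo] --> x.
Proof.
move=> PF.
have /choice[u up] : forall n : nat, exists y,
    [/\ `|x - y| < n.+1%:R^-1, D y & y != x].
  move=> n; apply: (@filter_ex _ _ PF).
  have : \forall y \near x, `|x - y| < n.+1%:R^-1.
    by apply/nbhs_ballP; exists n.+1%:R^-1 => //=; rewrite invr_gt0.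
  by apply: filterS => y xy yx Dy.
exists u; split; first by move=> n; have [] := up n.
apply/cvgrPdist_lt => d d0; near=> n.
have [+ _ _] := up n; move/lt_trans; apply.
by near: n; exact: near_infty_natSinv_lt (PosNum d0).
Unshelve. all: by end_near. Qed.

Section derivative_under_integral.
Context d (Y : measurableType d) {R : realType}
  (mu : {measure set Y -> \bar R}) (B : set Y) (D : set R) (x : R).
Variables (f : R -> Y -> R) (df G : Y -> R).
Hypotheses (mB : measurable B) (Dx : D x).
Hypothesis PF : ProperFilter (within D x^').
Hypothesis intf : forall y, D y -> mu.-integrable B (EFin \o f y).
Hypothesis intG : mu.-integrable B (EFin \o G).
Hypothesis leG : \forall y \near within D x^', forall z, B z ->
  `|diff_quot (f ^~ z) x y| <= G z.
Hypothesis fdf : forall z, B z -> has_derive_in D (f ^~ z) x (df z).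

Let seq_under_integral (u : R^nat) : (forall n, D (u n) /\ u n != x) ->
  u n @[n --> \oo] --> x ->
  mu.-integrable B (EFin \o df) /\
  diff_quot (fun y => \int[mu]_(z in B) f y z)%R x (u n) @[n --> \oo] -->
    (\int[mu]_(z in B) df z)%R.
Proof.
move=> Du ux.
have uin : u n @[n --> \oo] --> within D x^'.
  move=> P; rewrite /= nbhs_simpl/= => -[e /= e0 eP].
  move/cvgrPdist_lt : ux => /(_ _ e0); apply: filterS => n xu.
  by have [Dn nx] := Du n; exact: eP xu nx Dn.
have [N _ uN] : \forall n \near \oo, forall z, B z ->
    `|diff_quot (f ^~ z) x (u n)| <= G z by exact: uin leG.
pose g n z := diff_quot (f ^~ z) x (u (n + N)%N).
have intg n : mu.-integrable B (EFin \o g n).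
  rewrite /g /diff_quot /comp.
  under eq_fun do rewrite mulrC EFinM EFinB.
  by apply: integrableZl => //; apply: integrableB => //; apply: intf => //;
    have [] := Du (n + N)%N.
have gdf z : B z -> (EFin \o g ^~ z) n @[n --> \oo] --> (df z)%:E.
  move=> Bz; apply: cvg_EFin; first exact: nearW.
  have := cvg_comp _ _ uin (fdf z Bz).
  by rewrite -(cvg_shiftn N).
have mg n : measurable_fun B (fun z => (g n z)%:E) by case/integrableP: (intg n).
have gG n z : B z -> (`|(EFin \o g n) z| <= (EFin \o G) z)%E.
  by move=> Bz; rewrite lee_fin; apply: uN => //=; rewrite leq_addl.
have mdf : measurable_fun B (fun z => (df z)%:E).
  by apply: emeasurable_fun_cvg gdf => m; exact: mg.
have [idf _ cvgI] := @dominated_convergence _ _ _ mu _ mB (fun n => EFin \o g n)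
  (EFin \o df) (EFin \o G) mg mdf (aeW _ gdf) intG (aeW _ (fun z n => @gG n z)).
split=> //; rewrite -(cvg_shiftn N).
have : (\int[mu]_(z in B) g n z)%R @[n --> \oo] --> (\int[mu]_(z in B) df z)%R.
  apply/fine_cvg; rewrite -/(Rintegral _ _ _) /Rintegral fineK//.
  exact: integrable_fin_num.
apply: cvg_trans; apply: near_eq_cvg; apply/nearW => n /=.
have [Dn _] := Du (n + N)%N.
rewrite /diff_quot -RintegralB//; [|exact: intf..].
rewrite mulrC -RintegralZl//; last first.
  rewrite /comp; under eq_fun do rewrite EFinB.
  by apply: integrableB => //; exact: intf.
by apply: eq_Rintegral => z _; rewrite mulrC.
Qed.

Lemma derivative_under_integral_integrable : mu.-integrable B (EFin \o df).
Proof.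
have [u [Du ux]] := within_dnbhs_seq _ _ PF.
by have [] := seq_under_integral _ Du ux.
Qed.

Lemma has_derive_in_Rintegral :
  has_derive_in D (fun y => \int[mu]_(z in B) f y z)%R x
    (\int[mu]_(z in B) df z)%R.
Proof.
by apply: cvg_within_dnbhs_seq => u Du ux; have [] := seq_under_integral _ Du ux.
Qed.

End derivative_under_integral.

(** * Integrable powers *)

Section integrable_antiderivative.
Context {R : realType}.
Local Notation mu := (@lebesgue_measure R).

Lemma ge0_integrable_antiderivative (f F : R -> R) (I : set R) (l r : R^nat)
    (M : R) : open I -> (forall n, l n < r n) ->
  nonincreasing_seq l -> nondecreasing_seq r ->
  \bigcup_n `[l n, r n]%classic = I ->
  {in I, continuous f} ->
  (forall x, I x -> is_derive x 1 F (f x)) ->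
  (forall x, I x -> 0 <= f x) -> (forall x, I x -> `|F x| <= M) ->
  mu.-integrable I (EFin \o f).
Proof.
move=> oI lr dl dr IE cf dF f0 FM.
have mI : measurable I by exact: open_measurable.
have sub n : `[l n, r n]%classic `<=` I by move=> x xn; rewrite -IE; exists n.
have mf : measurable_fun I f by exact: open_continuous_measurable_fun.
apply/integrableP; split; first exact/measurable_EFinP.
have -> : (\int[mu]_(x in I) `|(EFin \o f) x| = \int[mu]_(x in I) (f x)%:E)%E.
  by apply: eq_integral => x /[!inE] Ix /=; rewrite ger0_norm// f0.
have nd : nondecreasing_seq (fun n => `[l n, r n]%classic).
  move=> m n mn; apply/subsetPset => x /=; rewrite !in_itv/= => /andP[lx xr].
  by rewrite (le_trans (dl _ _ mn) lx) (le_trans xr (dr _ _ mn)).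
have int_le n : (\int[mu]_(x in `[l n, r n]) (f x)%:E <= (M + M)%:E)%E.
  have dFn x : x \in `[l n, r n] -> is_derive x 1 F (f x).
    by move=> xlr; apply/dF/(sub n).
  rewrite (@continuous_FTC2 _ f F)//.
  - rewrite -EFinB lee_fin (le_trans (ler_norm _))// (le_trans (ler_normB _ _))//.
    by apply: lerD; apply/FM/(sub n); rewrite /= in_itv/= lexx ltW.
  - by apply: continuous_in_subspaceT => x /[!inE] /sub Ix; apply: cf; rewrite inE.
  - have cF x : x \in `[l n, r n] -> {for x, continuous F}.
      by move=> /dFn dFx; apply/differentiable_continuous/derivable1_diffP.
    split; first by move=> x /subset_itv_oo_cc /dFn dFx; exact: ex_derive.
    + by apply/cvg_at_right_filter/cF; rewrite in_itv/= lexx ltW.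
    + by apply/cvg_at_left_filter/cF; rewrite in_itv/= lexx ltW.
  - move=> x /subset_itv_oo_cc /dFn dFx; rewrite derive1E; exact: derive_val.
apply: (@le_lt_trans _ _ (M + M)%:E); last exact: ltry.
have cvgI : (\int[mu]_(x in `[l n, r n]) (f x)%:E)%E @[n --> \oo] -->
    (\int[mu]_(x in I) (f x)%:E)%E.
  rewrite -IE; apply: ge0_nondecreasing_set_cvg_integral => //.
  - by move=> n; apply/measurable_EFinP; apply: measurable_funS mf.
  - by move=> n x /sub Ix; rewrite lee_fin f0.
rewrite -(cvg_lim _ cvgI)//; apply: lime_le; first by apply/cvg_ex; eexists; exact: cvgI.
exact: nearW.
Qed.

End integrable_antiderivative.

Lemma is_derive_continuous {R : realType} (f : R -> R) (x l : R) :
  is_derive x 1 f l -> {for x, continuous f}.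
Proof. by move=> dfx; apply/differentiable_continuous/derivable1_diffP. Qed.

Lemma powR_le1 {R : realType} (x a : R) : 0 <= x <= 1 -> 0 <= a -> x `^ a <= 1.
Proof.
move=> /andP[x0 x1] a0; have := ge0_ler_powR a0 x0 (ler01 : 1 \is Num.nneg) x1.
by rewrite powR1.
Qed.

Section integrable_weights.
Context {R : realType}.
Local Notation mu := (@lebesgue_measure R).

Lemma bigcup_itvcc01 :
  \bigcup_n `[n.+3%:R^-1, 1 - n.+3%:R^-1]%classic = `]0, 1[%classic :> set R.
Proof.
apply/seteqP; split=> x /=.
  move=> [n _]; rewrite /= !in_itv/= => /andP[nx xn].
  have n0 : 0 < n.+3%:R^-1 :> R by rewrite invr_gt0.
  by move: (n.+3%:R^-1) n0 nx xn => c c0 cx xc; apply/andP; split; lra.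
rewrite in_itv/= => /andP[x0 x1].
have m0 : 0 < Num.min x (1 - x) by rewrite lt_min x0 subr_gt0.
have [n _ nm] := near_infty_natSinv_lt (PosNum m0).
have /= := nm n.+2 (leq_trans (leqnSn n) (leqnSn _)); rewrite lt_min => /andP[nx nx1].
exists n => //=; rewrite in_itv/=.
by move: (n.+3%:R^-1) nx nx1 => c cx xc; apply/andP; split; lra.
Qed.

Lemma bigcup_itvcc0y :
  \bigcup_n `[n.+2%:R^-1, n.+1%:R]%classic = `]0, +oo[%classic :> set R.
Proof.
apply/seteqP; split=> x /=.
  move=> [n _]; rewrite /= !in_itv/= andbT => /andP[nx _].
  by apply: lt_le_trans nx; rewrite invr_gt0.
rewrite in_itv/= andbT => x0.
have [n _ nm] := near_infty_natSinv_lt (PosNum x0).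
have [m _ mx] := nbhs_infty_ger x.
pose k := maxn n m.
exists k => //=; rewrite in_itv/=; apply/andP; split.
  by apply/ltW/(nm k.+1) => /=; rewrite (leq_trans (leq_maxl n m))// leqnSn.
by rewrite (le_trans (mx k (leq_maxr _ _)))// ler_nat.
Qed.

Lemma integrable_powR01 (q : R) : -1 < q ->
  mu.-integrable `]0, 1[ (EFin \o (fun z => z `^ q)).
Proof.
move=> q1; have q0 : 0 < q + 1 by lra.
apply: (@ge0_integrable_antiderivative _ _
  (fun z => (q + 1)^-1 * z `^ (q + 1)) _ (fun n => n.+3%:R^-1)
  (fun n => 1 - n.+3%:R^-1) (q + 1)^-1).
- exact: interval_open.
- move=> n; rewrite ltrBrDr -mulr2n -[_ *+ 2]mulr_natr ltr_pdivrMl ?mulr1// ltr_nat//.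
- by move=> m n mn; rewrite lef_pV2 ?posrE// ler_nat.
- by move=> m n mn; rewrite lerB// lef_pV2 ?posrE// ler_nat.
- exact: bigcup_itvcc01.
- move=> z; rewrite inE/= in_itv/= => /andP[z0 _].
  by apply: is_derive_continuous; exact: is_derive1_powR.
- move=> z; rewrite /= in_itv/= => /andP[z0 _].
  apply: (is_derive_eq (is_deriveZ _ (is_derive1_powR (q + 1) z0))).
  by rewrite addrK /GRing.scale/= mulKf// gt_eqF.
- by move=> z _; exact: powR_ge0.
- move=> z; rewrite /= in_itv/= => /andP[z0 z1].
  have q0' := ltW q0; have z0' := ltW z0; have z1' := ltW z1.
  rewrite ger0_norm ?mulr_ge0 ?invr_ge0 ?powR_ge0//.
  by rewrite ler_piMr ?invr_ge0// powR_le1// z0'.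
Qed.

Lemma is_derive1_powR_onem (a : R) [z : R] : z < 1 ->
  is_derive z 1 (fun z => (1 - z) `^ a) (- (a * (1 - z) `^ (a - 1))).
Proof.
rewrite -subr_gt0 => z1.
have d1 : is_derive z 1 (fun z : R => 1 - z) (-1).
  apply: (is_derive_eq (is_deriveB (is_derive_cst (1 : R) _ _) (is_derive_id _ _))).
  by rewrite sub0r.
have := @is_derive1_comp _ (@powR R ^~ a) (fun z => 1 - z) _ _ _
  (is_derive1_powR a z1) d1.
by rewrite mulrN1.
Qed.

Lemma integrable_powR_onem (p : R) : -1 < p ->
  mu.-integrable `]0, 1[ (EFin \o (fun z => (1 - z) `^ p)).
Proof.
move=> p1; have q0 : 0 < p + 1 by lra.
apply: (@ge0_integrable_antiderivative _ _
  (fun z => - (p + 1)^-1 * (1 - z) `^ (p + 1)) _ (fun n => n.+3%:R^-1)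
  (fun n => 1 - n.+3%:R^-1) (p + 1)^-1).
- exact: interval_open.
- move=> n; rewrite ltrBrDr -mulr2n -[_ *+ 2]mulr_natr ltr_pdivrMl ?mulr1// ltr_nat//.
- by move=> m n mn; rewrite lef_pV2 ?posrE// ler_nat.
- by move=> m n mn; rewrite lerB// lef_pV2 ?posrE// ler_nat.
- exact: bigcup_itvcc01.
- move=> z; rewrite inE/= in_itv/= => /andP[_ z1].
  by apply: is_derive_continuous; exact: is_derive1_powR_onem.
- move=> z; rewrite /= in_itv/= => /andP[_ z1].
  apply: (is_derive_eq (is_deriveZ _ (is_derive1_powR_onem (p + 1) z1))).
  by rewrite addrK /GRing.scale/= mulrNN mulKf// gt_eqF.
- by move=> z _; exact: powR_ge0.
- move=> z; rewrite /= in_itv/= => /andP[z0 z1].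
  have q0' := ltW q0.
  rewrite mulNr normrN ger0_norm ?mulr_ge0 ?invr_ge0 ?powR_ge0//.
  by rewrite ler_piMr ?invr_ge0// powR_le1//; lra.
Qed.

Lemma integrable_powR_onem_powR (p q : R) : -1 < p <= 0 -> -1 < q <= 0 ->
  mu.-integrable `]0, 1[ (EFin \o (fun z => (1 - z) `^ p * z `^ q)).
Proof.
move=> /andP[p1 p0] /andP[q1 q0].
have half (x r : R) : 2^-1 <= x <= 1 -> -1 < r -> x `^ r <= 2.
  move=> /andP[x2 x1] r1; have x0 : 0 < x by lra.
  rewrite -[r]opprK powRN -[leRHS]invrK lef_pV2 ?posrE ?powR_gt0//.
  by apply: (le_trans x2); apply: ger1_powR; rewrite ?x0//; lra.
apply: (@le_integrable _ _ _ mu _ _ _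
  (EFin \o (fun z => 2 * (z `^ q + (1 - z) `^ p)))) => //.
- apply/measurable_EFinP; apply: open_continuous_measurable_fun.
    exact: interval_open.
  move=> z; rewrite inE/= in_itv/= => /andP[z0 z1].
  exact: (is_derive_continuous _ _ _
    (is_deriveM (is_derive1_powR_onem p z1) (is_derive1_powR q z0))).
- move=> z; rewrite /= in_itv/= => /andP[z0 z1].
  rewrite lee_fin !ger0_norm ?mulr_ge0 ?addr_ge0 ?powR_ge0//.
  have [z2|z2] := leP z 2^-1.
  + apply: (@le_trans _ _ (2 * z `^ q)).
      by rewrite ler_wpM2r ?powR_ge0// half//; lra.
    by rewrite ler_pM2l// lerDl powR_ge0.
  + apply: (@le_trans _ _ (2 * (1 - z) `^ p)).
      by rewrite mulrC ler_wpM2r ?powR_ge0// half//; lra.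
    by rewrite ler_pM2l// lerDr powR_ge0.
- have -> : EFin \o (fun z => 2 * (z `^ q + (1 - z) `^ p)) =
      (fun z => 2%:E * ((z `^ q)%:E + ((1 - z) `^ p)%:E))%E.
    by apply/funext => z; rewrite /= EFinM EFinD.
  apply: integrableZl => //; apply: integrableD => //.
  + exact: integrable_powR01.
  + exact: integrable_powR_onem.
Qed.

Lemma integrable_powR_fraction (c : R) : 0 < c ->
  mu.-integrable `]0, +oo[
    (EFin \o (fun s => s `^ (c - 1) / ((1 + s `^ c) * (1 + s `^ c)))).
Proof.
move=> c0.
have pos s : 0 < 1 + s `^ c by rewrite ltr_pwDl// powR_ge0.
have dden (s : R) : 0 < s -> is_derive s 1 (fun s => 1 + s `^ c) (c * s `^ (c - 1)).
  move=> s0; apply: (is_derive_eq (is_deriveD (is_derive_cst (1 : R) _ _)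
    (is_derive1_powR c s0))).
  by rewrite add0r.
apply: (@ge0_integrable_antiderivative _ _
  (fun s => - c^-1 * (1 + s `^ c)^-1) _ (fun n => n.+2%:R^-1)
  (fun n => n.+1%:R) c^-1).
- exact: interval_open.
- move=> n; rewrite (@lt_le_trans _ _ 1)// ?ler1n//.
  by rewrite invf_lt1 ?ltr1n.
- by move=> m n mn; rewrite lef_pV2 ?posrE// ler_nat.
- by move=> m n mn; rewrite ler_nat.
- exact: bigcup_itvcc0y.
- move=> s; rewrite inE/= in_itv/= andbT => s0.
  have d1 : (1 + s `^ c) * (1 + s `^ c) != 0 by rewrite mulf_neq0// gt_eqF.
  have cden := is_derive_continuous _ _ _ (dden s s0).
  apply: (@cvgM _ _ _ _ (fun s => s `^ (c - 1))
    (fun s => ((1 + s `^ c) * (1 + s `^ c))^-1)).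
    exact: is_derive_continuous _ _ _ (is_derive1_powR _ s0).
  by apply: (@cvgV _ _ _ _ (fun s => (1 + s `^ c) * (1 + s `^ c))) => //; exact: cvgM.
- move=> s; rewrite /= in_itv/= andbT => s0.
  have d1 : 1 + s `^ c != 0 by rewrite gt_eqF.
  have dV := @is_deriveV _ (fun s : R => 1 + s `^ c) _ _ _ d1 (dden s s0).
  apply: (is_derive_eq (is_deriveZ (- c^-1) dV)).
  by rewrite /GRing.scale/=; field; rewrite d1 gt_eqF.
- by move=> z _; rewrite divr_ge0 ?powR_ge0// mulr_ge0// ltW.
- move=> s; rewrite /= in_itv/= andbT => s0.
  have c0' := ltW c0; have d0 := ltW (pos s).
  rewrite mulNr normrN ger0_norm ?mulr_ge0 ?invr_ge0//.
  by rewrite ler_piMr ?invr_ge0// invf_le1// lerDl powR_ge0.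
Qed.

End integrable_weights.

(** * Derivatives of the Gamma function *)

Lemma exprn_le_expR {R : realType} (n : nat) (x : R) : 0 <= x ->
  x ^+ n <= n`!%:R * expR x.
Proof.
move=> x0; case: n => [|n]; first by rewrite expr0 fact0 mul1r -[leLHS]expR0 ler_expR.
rewrite mulrC -ler_pdivrMr ?ltr0n ?fact_gt0//.
by rewrite (le_trans _ (expR_ge1Dxn n x0))// lerDr.
Qed.

Section gamma_derivatives.
Context {R : realType}.
Local Notation mu := (@lebesgue_measure R).

Definition gamma_kernel (k : nat) (x s : R) : R :=
  ln s ^+ k * (s `^ (x - 1) * expR (- s)).

Definition gamma_derive (k : nat) (x : R) : R :=
  \int[mu]_(s in `]0, +oo[) gamma_kernel k x s.

Lemma GammaE : @Gamma R = gamma_derive 0.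
Proof.
apply/funext => x; rewrite /Gamma /gamma_derive /gamma_kernel.
by under [RHS]eq_Rintegral do rewrite expr0 mul1r.
Qed.

(* The dominating function has the bounded antiderivative - 1 / (c (1 + s^c)). *)
Lemma gamma_kernel_le (k : nat) (c x s : R) : 0 < c <= 1 ->
  2 * c <= x <= 2 -> 0 < s ->
  `|gamma_kernel k x s| <= 4 * (k`!%:R / c ^+ k + (k + 4)`!%:R) *
    (s `^ (c - 1) / ((1 + s `^ c) * (1 + s `^ c))).
Proof.
move=> /andP[c0 c1] /andP[cx x2] s0; have s0' := ltW s0; have c0' := ltW c0.
have sc0 : 0 < s `^ c by exact: powR_gt0.
have sc1 : 0 < s `^ (c - 1) by exact: powR_gt0.
have E0 := expR_ge0 (- s).
rewrite /gamma_kernel normrM normrX [X in _ * X]ger0_norm; last first.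
  by rewrite mulr_ge0 ?powR_ge0.
have K10 : 0 <= k`!%:R / c ^+ k by rewrite divr_ge0// exprn_ge0.
have K20 : 0 <= (k + 4)`!%:R :> R by [].
have L0 : 0 <= `|ln s| ^+ k by rewrite exprn_ge0.
rewrite [leRHS]mulrA ler_pdivlMr ?mulr_gt0 ?addr_gt0//.
have [s1|/ltW s1] := leP s 1.
- have lnk : `|ln s| ^+ k * s `^ c <= k`!%:R / c ^+ k.
    have lns0 : ln s <= 0 by exact: ln_le0.
    rewrite ler_pdivlMr ?exprn_gt0// mulrAC -exprMn ler0_norm//.
    have := @exprn_le_expR _ k (- ln s * c).
    rewrite mulr_ge0 ?oppr_ge0// => /(_ isT) H.
    rewrite /powR gt_eqF// (le_trans (ler_wpM2r (expR_ge0 _) H))//.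
    by rewrite -mulrA -expRD mulNr [c * _]mulrC addNr expR0 mulr1.
  have sx : s `^ (x - 1) <= s `^ c * s `^ (c - 1).
    rewrite -powRD; last by rewrite (gt_eqF s0) implybT.
    by apply: ger_powR; rewrite ?s0//; lra.
  have sc : s `^ c <= 1 by rewrite powR_le1// s0'.
  have es : expR (- s) <= 1 by rewrite -[leRHS]expR0 ler_expR oppr_le0.
  have den : (1 + s `^ c) * (1 + s `^ c) <= 4 by nra.
  have xe : s `^ (x - 1) * expR (- s) <= s `^ c * s `^ (c - 1).
    by rewrite (le_trans _ sx)// ler_piMr ?powR_ge0.
  have Lxe : `|ln s| ^+ k * (s `^ (x - 1) * expR (- s)) <=
      k`!%:R / c ^+ k * s `^ (c - 1).
    by rewrite (le_trans (ler_wpM2l L0 xe))// mulrA ler_wpM2r// ltW.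
  apply: (@le_trans _ _ (k`!%:R / c ^+ k * s `^ (c - 1) * 4)).
    by apply: ler_pM; rewrite // mulr_ge0// ?mulr_ge0 ?powR_ge0 ?addr_ge0// ltW.
  by have := mulr_ge0 K20 (ltW sc1); lra.
- have lns : `|ln s| <= s.
    rewrite ger0_norm ?ln_ge0//; have : ln (1 + (s - 1)) <= s - 1.
      by apply: le_ln1Dx; lra.
    by rewrite addrC subrK => /le_trans; apply; lra.
  have lnk : `|ln s| ^+ k <= s ^+ k by rewrite lerXn2r ?nnegrE.
  have ss r : r <= 1 -> s `^ r <= s by move=> r1; rewrite ler1_powR.
  have scE : s `^ c = s `^ (c - 1) * s.
    by rewrite mulrC mulr_powRB1.
  have sc : 1 <= s `^ c by rewrite -[leLHS](powRr0 s); apply: ler_powR.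
  have es : s ^+ (k + 4) * expR (- s) <= (k + 4)`!%:R.
    by rewrite expRN ler_pdivrMr ?expR_gt0// exprn_le_expR.
  have sx : s `^ (x - 1) <= s by apply: ss; lra.
  have den : (1 + s `^ c) * (1 + s `^ c) <= 4 * (s `^ (c - 1) * s * s).
    have := ss c c1; rewrite -scE; nra.
  have Lxe : `|ln s| ^+ k * (s `^ (x - 1) * expR (- s)) <=
      s ^+ k * (s * expR (- s)).
    by apply: ler_pM; rewrite ?mulr_ge0 ?powR_ge0 ?ler_wpM2r.
  apply: (@le_trans _ _ (s ^+ k * (s * expR (- s)) * (4 * (s `^ (c - 1) * s * s)))).
    by apply: ler_pM; rewrite ?(mulr_ge0, addr_ge0, powR_ge0, exprn_ge0).
  rewrite (_ : s ^+ k * _ * _ = 4 * (s ^+ k.+3 * expR (- s)) * s `^ (c - 1)); last first.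
    by rewrite !exprSr; ring.
  rewrite ler_pM2r// ler_pM2l//.
  rewrite (le_trans _ (le_trans es _))// ?lerDr// ler_wpM2r//.
  by apply: ler_weXn2l; rewrite ?addn4.
Qed.

Lemma integrable_gamma_dominator (K c : R) : 0 < c ->
  mu.-integrable `]0, +oo[ (EFin \o (fun s => K *
    (s `^ (c - 1) / ((1 + s `^ c) * (1 + s `^ c))))).
Proof.
move=> c0; rewrite (_ : EFin \o _ = (fun s => K%:E *
    (s `^ (c - 1) / ((1 + s `^ c) * (1 + s `^ c)))%:E)%E); last first.
  by apply/funext => s; rewrite /= EFinM.
by apply: integrableZl => //; exact: integrable_powR_fraction.
Qed.

Lemma integrable_gamma_kernel (k : nat) (x : R) : 0 < x <= 2 ->
  mu.-integrable `]0, +oo[ (EFin \o gamma_kernel k x).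
Proof.
move=> /andP[x0 x2].
have c0 : 0 < x / 2 by rewrite divr_gt0.
apply: (le_integrable _ _ _ (integrable_gamma_dominator
  (4 * (k`!%:R / (x / 2) ^+ k + (k + 4)`!%:R)) _ c0)) => //.
- apply/measurable_EFinP; apply: open_continuous_measurable_fun.
    exact: interval_open.
  move=> s; rewrite inE/= in_itv/= andbT => s0.
  apply: (@cvgM _ _ _ _ (fun s => ln s ^+ k) (fun s => s `^ (x - 1) * expR (- s))).
    apply: (@continuous_comp _ _ _ (@ln R) (fun y => y ^+ k)).
      exact: continuous_ln.
    exact: exprn_continuous.
  apply: (@cvgM _ _ _ _ (fun s => s `^ (x - 1)) (fun s => expR (- s))).
    exact: is_derive_continuous (is_derive1_powR _ s0).
  apply: (@continuous_comp _ _ _ -%R (@expR R)); first exact: oppr_continuous.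
  exact: continuous_expR.
- move=> s; rewrite /= in_itv/= andbT => s0; rewrite lee_fin.
  apply: (le_trans _ (ler_norm _)); apply: gamma_kernel_le => //.
  + by rewrite c0/=; lra.
  + by apply/andP; split; lra.
Qed.

Lemma is_derive_gamma_kernel (k : nat) (x s : R) : 0 < s ->
  is_derive x 1 (gamma_kernel k ^~ s) (gamma_kernel k.+1 x s).
Proof.
move=> s0.
have dlin : is_derive x 1 (fun x : R => ln s * (x - 1)) (ln s).
  apply: (is_derive_eq (is_deriveZ (ln s)
    (is_deriveB (is_derive_id x 1) (is_derive_cst (1 : R) _ _)))).
  by rewrite subr0 /GRing.scale/= mulr1.
have dexp := @is_derive1_comp _ expR (fun x : R => ln s * (x - 1)) _ _ _
  (is_derive_expR _) dlin.
have -> : gamma_kernel k ^~ s = (fun x =>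
    (ln s ^+ k * expR (- s)) *: (expR \o (fun x => ln s * (x - 1))) x).
  apply/funext => y; rewrite /gamma_kernel /powR gt_eqF// /GRing.scale/=.
  by rewrite [(y - 1) * _]mulrC; ring.
apply: (is_derive_eq (is_deriveZ _ dexp)).
rewrite /gamma_kernel /powR gt_eqF// /GRing.scale/= exprSr.
by rewrite [(x - 1) * _]mulrC; ring.
Qed.

Lemma is_derive_gamma_derive (k : nat) (x : R) : 0 < x < 2 ->
  is_derive x 1 (gamma_derive k) (gamma_derive k.+1 x).
Proof.
move=> /andP[x0 x2].
have c0 : 0 < x / 4 by rewrite divr_gt0.
pose c := x / 4.
pose G s := 4 * (k.+1`!%:R / c ^+ k.+1 + (k.+1 + 4)`!%:R) *
    (s `^ (c - 1) / ((1 + s `^ c) * (1 + s `^ c))).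
have d1E (y s : R) : `]0, +oo[%classic s ->
    partial1of2 (gamma_kernel k) y s = gamma_kernel k.+1 y s.
  rewrite /= in_itv/= andbT => s0; rewrite partial1of2E.
  by have dk := is_derive_gamma_kernel k y _ s0; exact: derive_val.
have mI : measurable (`]0, +oo[%classic : set R) by [].
have Ix : `]x / 2, 2[%classic x by rewrite /= in_itv/=; apply/andP; split; lra.
have int_y y : `]x / 2, 2[%classic y ->
    mu.-integrable `]0, +oo[ (EFin \o gamma_kernel k y).
  rewrite /= in_itv/= => /andP[xy y2]; apply: integrable_gamma_kernel.
  by apply/andP; split; lra.
have der (y s : R) : `]x / 2, 2[%classic y -> `]0, +oo[%classic s ->
    derivable (gamma_kernel k ^~ s) y 1.
  move=> _; rewrite /= in_itv/= andbT => s0.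
  by have dk := is_derive_gamma_kernel k y _ s0; exact: ex_derive.
have G0 (s : R) : 0 <= G s.
  by rewrite /G ?(mulr_ge0, addr_ge0, powR_ge0, exprn_ge0, invr_ge0) ?ltW.
have intG : mu.-integrable `]0, +oo[ (EFin \o G).
  exact: integrable_gamma_dominator.
have Gub (y s : R) : `]x / 2, 2[%classic y -> `]0, +oo[%classic s ->
    `|partial1of2 (gamma_kernel k) y s| <= G s.
  move=> + Is; rewrite d1E//; move: Is.
  rewrite /= !in_itv/= andbT => s0 /andP[xy y2]; apply: gamma_kernel_le => //.
  + by rewrite c0/=; rewrite /c; lra.
  + by rewrite /c; apply/andP; split; lra.
apply: DeriveDef.
  exact: (@derivable_under_integral _ _ _ mu (gamma_kernel k) _ mI _ _ _ Ix
    int_y der _ G0 intG Gub).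
rewrite -derive1E (@differentiation_under_integral _ _ _ mu (gamma_kernel k) _ mI
  _ _ _ Ix int_y der _ G0 intG Gub).
by apply: eq_Rintegral => s; rewrite inE => Is; exact: d1E.
Qed.

Lemma gamma_derive0_gt0 (x : R) : 0 < x <= 2 -> 0 < gamma_derive 0 x.
Proof.
move=> x02; have intx := integrable_gamma_kernel 0 x x02.
case/andP: x02 => x0 x2.
have mK : measurable_fun (`]0, +oo[%classic : set R) (gamma_kernel 0 x).
  by case/integrableP: intx => /measurable_EFinP.
have K0 s : 0 <= gamma_kernel 0 x s.
  by rewrite /gamma_kernel expr0 mul1r mulr_ge0 ?powR_ge0 ?expR_ge0.
have sub : `[1, 2]%classic `<=` (`]0, +oo[%classic : set R).
  by move=> s; rewrite /= !in_itv/= andbT => /andP[s1 _]; rewrite (lt_le_trans _ s1).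
have Ioo : (\int[mu]_(s in `]0%R, +oo[) (gamma_kernel 0 x s)%:E < +oo)%E.
  by rewrite ltey_eq (integrable_fin_num _ intx).
rewrite /gamma_derive /Rintegral fine_gt0// Ioo andbT.
apply: (@lt_le_trans _ _ (\int[mu]_(s in `[1%R, 2%R]) (2^-1 * expR (- 2))%:E)%E).
  rewrite integral_cst//= lebesgue_measure_itv/= lte_fin ltr1n -EFinD -EFinM lte_fin.
  by rewrite mulr_gt0 ?mulr_gt0 ?expR_gt0//; lra.
apply: (@le_trans _ _
    (\int[mu]_(s in `[1%R, 2%R]) (gamma_kernel 0 x s)%:E)%E); last first.
  apply: ge0_subset_integral => //; first exact/measurable_EFinP.
  by move=> s _; rewrite lee_fin.
apply: ge0_le_integral => //.
- by apply/measurable_EFinP; apply: measurable_funS mK.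
- move=> s; rewrite /= in_itv/= => /andP[s1 s2]; rewrite lee_fin.
  rewrite /gamma_kernel expr0 mul1r ler_pM ?expR_ge0 ?ler_expR ?lerN2//.
  apply: (@le_trans _ _ (s `^ (-1))); last by apply: ler_powR => //; lra.
  by rewrite powR_inv1 ?(le_trans _ s1)// lef_pV2 ?posrE ?(lt_le_trans _ s1).
Qed.

End gamma_derivatives.

(** * Inverses, dilations and bounds *)

Section within_segment.
Context {R : realType}.
Implicit Types (f g : R -> R).

Lemma has_derive_inV (D : set R) f (x l : R) : f x != 0 ->
  has_derive_in D f x l ->
  has_derive_in D (fun y => (f y)^-1) x (- (f x)^-1 * (f x)^-1 * l).
Proof.
move=> fx0; apply: has_derive_in_comp.
apply: (is_derive_eq (@is_deriveV _ id _ _ _ fx0 (is_derive_id _ _))).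
by rewrite /GRing.scale/= mulr1 -exprVn expr2 mulNr.
Qed.

Lemma has_derive_in_scale (D : set R) f (z t l : R) : z != 0 ->
  (forall y, D y -> D (y * z)) -> has_derive_in D f (t * z) l ->
  has_derive_in D (fun y => f (y * z)) t (z * l).
Proof.
move=> z0 Dz fl.
have sc : (y * z) @[y --> within D t^'] --> within D (t * z)^'.
  have cz : y * z @[y --> within D t^'] --> t * z.
    by apply: cvgMl; exact: within_dnbhs_cvg.
  move=> P [e /= e0 eP]; move/cvgrPdist_lt : cz => /(_ _ e0).
  have Dn : \forall y \near within D t^', D y /\ y != t.
    by rewrite near_withinE near_withinE; apply/nearW.
  apply: filterS2 Dn => y /= [Dy yneq] yt.
  apply: eP => //; last exact: Dz.
  by apply: contra yneq => /eqP/(mulIf z0)/eqP.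
have : (z * diff_quot f (t * z) (y * z)) @[y --> within D t^'] --> z * l.
  by apply: cvgM; [exact: cvg_cst|exact: (cvg_comp _ _ sc fl)].
apply: cvg_trans; apply: near_eq_cvg; apply/nearW => y /=.
by rewrite /diff_quot -mulrBl invfM mulrCA [z * (_ / _)]mulrCA mulfV// mulr1 mulrC.
Qed.

Lemma has_derive_in_within_continuous (D A : set R) f (f1 : R -> R) :
  A `<=` D -> (forall s, A s -> has_derive_in D f s (f1 s)) ->
  {within A, continuous f}.
Proof.
move=> AD df; apply/subspace_continuousP => x Ax.
have := has_derive_in_continuous _ _ _ _ (df x Ax).
move=> cf; apply/cvgrPdist_lt => e e0; move/cvgrPdist_lt : cf => /(_ _ e0).
rewrite near_withinE near_withinE near_withinE; apply: filterS => y fy Ay.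
have [->|yx] := eqVneq y x; first by rewrite subrr normr0.
exact: fy yx (AD _ Ay).
Qed.

Lemma has_derive_in_bounded (a b : R) f (f1 : R -> R) :
  (forall s, a <= s <= b -> has_derive_in `[a, b]%classic f s (f1 s)) ->
  exists M, forall s, a <= s <= b -> `|f s| <= M.
Proof.
move=> df.
have cf : {within `[a, b], continuous f}.
  exact: (@has_derive_in_within_continuous `[a, b]%classic _ _ f1).
have [M [_ Mf]] := compact_bounded (continuous_compact cf (@segment_compact _ a b)).
exists (M + 1) => s sab; apply: (Mf (M + 1)); first by rewrite ltrDl.
by exists s => //; rewrite /= in_itv.
Qed.

Lemma has_derive_in_lipschitz (D : set R) (c b K : R) f (f1 : R -> R) :
  `[c, b]%classic `<=` D ->
  (forall s, c <= s <= b -> has_derive_in D f s (f1 s)) ->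
  (forall s, c <= s <= b -> `|f1 s| <= K) ->
  forall x y, c <= x <= b -> c <= y <= b -> `|f y - f x| <= K * `|y - x|.
Proof.
move=> cbD df fK.
suff H x y : c <= x <= b -> c <= y <= b -> x < y ->
    `|f y - f x| <= K * `|y - x|.
  move=> x y xcb ycb; have [xy|yx|->] := ltgtP x y; first exact: H.
  - by rewrite distrC [`|y - x|]distrC; exact: H.
  - by rewrite !subrr normr0 mulr0.
move=> /andP[cx xb] /andP[cy yb] xy.
have dfi z : z \in `]x, y[ -> is_derive z 1 f (f1 z).
  rewrite in_itv/= => /andP[xz zy].
  apply: has_derive_in_is_derive; last by apply: df; apply/andP; split; lra.
  have : z \in `]c, b[ by rewrite in_itv/=; apply/andP; split; lra.
  by move=> /near_in_itvoo; apply: filterS => w /subset_itv_oo_cc; exact: cbD.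
have cf : {within `[x, y], continuous f}.
  apply: (@has_derive_in_within_continuous D _ _ f1) => s.
    rewrite /= in_itv/= => /andP[xs sy]; apply: cbD.
    by rewrite /= in_itv/=; apply/andP; split; lra.
  by rewrite /= in_itv/= => /andP[xs sy]; apply: df; apply/andP; split; lra.
have [z zxy ->] := MVT xy dfi cf.
rewrite normrM ler_wpM2r//; apply: fK.
by move: zxy; rewrite in_itv/= => /andP[xz zy]; apply/andP; split; lra.
Qed.

End within_segment.

(** * Integrals of dilated functions *)

Lemma normr_ln_le {R : realType} (s : R) : 0 < s -> `|ln s| <= s^-1 + s.
Proof.
move=> s0; have le_ln (x : R) : 0 < x -> ln x <= x.
  move=> x0; have : ln (1 + (x - 1)) <= x - 1 by apply: le_ln1Dx; lra.
  by rewrite addrC subrK => /le_trans; apply; lra.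
have si0 : 0 < s^-1 by rewrite invr_gt0.
rewrite ler_norml; apply/andP; split.
  rewrite -[leRHS]opprK lerN2 -lnV ?posrE//.
  by rewrite (le_trans (le_ln _ si0))// lerDl ltW.
by rewrite (le_trans (le_ln _ s0))// lerDr ltW.
Qed.

Lemma mulr_normr_ln_le {R : realType} (s : R) : 0 < s ->
  s * `|ln s| <= 1 + s ^+ 2.
Proof.
move=> s0; rewrite (le_trans (ler_wpM2l (ltW s0) (normr_ln_le _ s0)))//.
by rewrite mulrDr mulfV ?gt_eqF// expr2.
Qed.

Section dilated_integral.
Context {R : realType}.
Local Notation mu := (@lebesgue_measure R).
Variables (T K : R) (h h1 h2 w : R -> R).
Hypotheses (T0 : 0 < T) (w0 : forall z : R, 0 <= w z).
Hypothesis intw : mu.-integrable `]0, 1[ (EFin \o w).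
Hypothesis dh : forall s : R, 0 <= s <= T ->
  has_derive_in `[0, T]%classic h s (h1 s).
Hypothesis h1K : forall s : R, 0 <= s <= T -> `|h1 s| <= K.
Hypothesis dh1 : forall s : R, 0 < s <= T ->
  has_derive_in `[0, T]%classic h1 s (h2 s).
Hypothesis h2K : forall s : R, 0 < s <= T -> `|h2 s| <= K * (`|ln s| + 1).

Local Notation D := (`[0, T]%classic : set R).
Local Notation I := (`]0, 1[%classic : set R).

Let K0 : 0 <= K.
Proof. by rewrite (le_trans _ (h1K 0 _))// lexx ltW. Qed.

Let mulz_seg (z : R) : I z -> forall y, D y -> D (y * z).
Proof.
rewrite /= in_itv/= => /andP[z0 z1] y; rewrite /= !in_itv/= => /andP[y0 yT].
by rewrite mulr_ge0 ?(ltW z0)//= (le_trans _ yT)// ler_piMr ?(ltW z1).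
Qed.

Let int_bounded (f : R -> R) (M : R) : measurable_fun I f ->
  (forall z : R, I z -> `|f z| <= M) ->
  mu.-integrable I (EFin \o (fun z => f z * w z)).
Proof.
move=> mf fM; have mw : measurable_fun I w.
  by case/integrableP: intw => /measurable_EFinP.
apply: (@le_integrable _ _ _ mu _ _ _ (EFin \o (fun z => M * w z))) => //.
- by apply/measurable_EFinP; exact: measurable_funM.
- move=> z Iz; rewrite /= lee_fin !normrM ler_wpM2r//.
  by rewrite (le_trans (fM z Iz))// ler_norm.
- have -> : EFin \o (fun z => M * w z) = (fun z => M%:E * (EFin \o w) z)%E.
    by apply/funext => z; rewrite /= EFinM.
  exact: integrableZl.
Qed.

Let int_dominator (M : R) : mu.-integrable I (EFin \o (fun z => M * w z)).
Proof. by apply: (int_bounded (fun=> M) `|M|) => //. Qed.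

Let le_int (f : R -> R) (M : R) :
  mu.-integrable I (EFin \o f) -> (forall z : R, I z -> `|f z| <= M * w z) ->
  `|\int[mu]_(z in I) f z| <= M * \int[mu]_(z in I) w z.
Proof.
move=> intf fM; rewrite (le_trans (le_normr_Rintegral _ intf))//.
rewrite -RintegralZl//; apply: le_Rintegral => //.
by move/integrable_norm : intf.
Qed.

Let measurable_dilation (t : R) : D t -> measurable_fun I (fun z => h (t * z)).
Proof.
rewrite /= in_itv/= => /andP[t0 tT].
have [->|tn0] := eqVneq t 0.
  rewrite (_ : (fun z => _) = cst (h 0)); first exact: measurable_cst.
  by apply/funext => z; rewrite mul0r.
have tp : 0 < t by rewrite lt_neqAle eq_sym tn0.
apply: open_continuous_measurable_fun; first exact: interval_open.
move=> z; rewrite inE/= in_itv/= => /andP[z0 z1].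
have tz0 : 0 < t * z by rewrite mulr_gt0.
have tzT : t * z < T by rewrite (lt_le_trans _ tT)// gtr_pMr.
apply: (@continuous_comp _ _ _ ( *%R t) h); first exact: mulrl_continuous.
apply: is_derive_continuous (h1 (t * z)) _.
apply: has_derive_in_is_derive; last by apply: dh; rewrite !ltW.
have : t * z \in `]0, T[ by rewrite in_itv/= tz0.
by move=> /near_in_itvoo; apply: filterS => y; exact: subset_itv_oo_cc.
Qed.

Let F (t z : R) := h (t * z) * w z.
Let F1 (t z : R) := z * h1 (t * z) * w z.
Let F2 (t z : R) := z * (z * h2 (t * z)) * w z.

Lemma integrable_dilation (t : R) : D t ->
  mu.-integrable I (EFin \o (fun z => h (t * z) * w z)).
Proof.
move=> Dt; apply: (int_bounded _ (`|h 0| + K * T)); first exact: measurable_dilation.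
move=> z Iz; have := mulz_seg z Iz t Dt; rewrite /= in_itv/= => tz.
have D0 : (0 : R) <= 0 <= T by rewrite lexx ltW.
have := has_derive_in_lipschitz _ _ _ _ _ _ (@subset_refl _ D) dh h1K 0 (t * z) D0 tz.
rewrite subr0 => hl; rewrite -lerBlDl (le_trans (lerB_dist _ _))// (le_trans hl)//.
by case/andP: tz => tz0 tzT; rewrite ler_wpM2l// ger0_norm.
Qed.

Let intF t : D t -> mu.-integrable I (EFin \o F t).
Proof. exact: integrable_dilation. Qed.

Let PF t : D t -> ProperFilter (within D t^').
Proof. by rewrite /= in_itv/=; exact: within_itvcc_proper. Qed.

Let dF t z : D t -> I z -> has_derive_in D (F ^~ z) t (F1 t z).
Proof.
move=> Dt Iz; have z0 : z != 0.
  by move: Iz; rewrite /= in_itv/= => /andP[z0 _]; rewrite gt_eqF.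
rewrite /F1 -[X in has_derive_in _ _ _ X]addr0 -{2}(mulr0 (h (t * z))).
apply: has_derive_inM; last exact: has_derive_in_cst.
apply: has_derive_in_scale => //; first exact: mulz_seg.
by apply: dh; have := mulz_seg z Iz t Dt; rewrite /= in_itv.
Qed.

Let leF t : D t -> \forall y \near within D t^', forall z : R, I z ->
  `|diff_quot (F ^~ z) t y| <= K * w z.
Proof.
move=> Dt; rewrite near_withinE near_withinE; apply/nearW => y yt Dy z Iz.
have := mulz_seg z Iz t Dt; rewrite /= in_itv/= => tz.
have := mulz_seg z Iz y Dy; rewrite /= in_itv/= => yz.
have := has_derive_in_lipschitz _ _ _ _ _ _ (@subset_refl _ D) dh h1K _ _ tz yz.
move: Iz; rewrite /= in_itv/= => /andP[z0 z1] hl.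
rewrite /diff_quot /F -mulrBl mulrAC normrM [`|w z|]ger0_norm// ler_wpM2r//.
rewrite normrM normfV ler_pdivrMr ?normr_gt0 ?subr_eq0// (le_trans hl)//.
by rewrite -mulrBl normrM mulrA ler_piMr ?mulr_ge0// ger0_norm ltW.
Qed.

Let intF1 t : D t -> mu.-integrable I (EFin \o F1 t).
Proof.
move=> Dt; have PFt := PF t Dt.
apply: (derivative_under_integral_integrable _ _ mu I D t F (F1 t)
  (fun z => K * w z)) => //.
- exact: leF.
- by move=> z; exact: dF.
Qed.

Let D_of (t : R) : 0 < t <= T -> D t.
Proof. by rewrite /= in_itv/= => /andP[/ltW ->]. Qed.

Let dF1 (t z : R) : 0 < t <= T -> I z -> has_derive_in D (F1 ^~ z) t (F2 t z).
Proof.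
move=> t0T Iz; have := Iz; rewrite /= in_itv/= => /andP[z0 z1].
have tz : 0 < t * z <= T.
  have := mulz_seg z Iz t (D_of t t0T); rewrite /= in_itv/= => /andP[_ ->].
  by case/andP: t0T => t0 _; rewrite mulr_gt0.
rewrite /F2 -[X in has_derive_in _ _ _ X]addr0 -{2}(mulr0 (z * h1 (t * z))).
apply: has_derive_inM; last exact: has_derive_in_cst.
have zN0 : z != 0 by rewrite gt_eqF.
have := has_derive_inM _ _ _ _ _ _ (has_derive_in_cst D t z)
  (has_derive_in_scale _ _ _ _ _ zN0 (mulz_seg z Iz) (dh1 _ tz)).
by rewrite mul0r add0r.
Qed.

(* For y > t / 2 both t z and y z exceed c = t z / 2, beyond which h2 is bounded
   by K (1 / c + T + 1); the factor z absorbs 1 / c. *)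
Let leF1 (t : R) : 0 < t <= T -> \forall y \near within D t^', forall z, I z ->
  `|diff_quot (F1 ^~ z) t y| <= K * (2 / t + T + 1) * w z.
Proof.
move=> t0T; have /andP[t0 tT] := t0T.
have near_y : \forall y \near t, t / 2 < y.
  have : t \in `]t / 2, +oo[ by rewrite in_itv/= andbT; lra.
  by move=> /near_in_itvoy; apply: filterS => y; rewrite in_itv/= andbT.
rewrite near_withinE near_withinE; apply: filterS near_y => y ty yt Dy z Iz.
have := Iz; rewrite /= in_itv/= => /andP[z0 z1].
have := mulz_seg z Iz t (D_of t t0T); rewrite /= in_itv/= => /andP[_ tzT].
have := mulz_seg z Iz y Dy; rewrite /= in_itv/= => /andP[_ yzT].
pose c := t / 2 * z.
have c0 : 0 < c by rewrite !mulr_gt0.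
have cD : `[c, T]%classic `<=` D.
  by move=> s; rewrite /= !in_itv/= => /andP[cs ->]; rewrite (le_trans (ltW c0)).
have h2c s : c <= s <= T -> `|h2 s| <= K * (c^-1 + T + 1).
  move=> /andP[cs sT]; have s0 := lt_le_trans c0 cs.
  rewrite (le_trans (h2K s _)) ?s0//= ler_wpM2l// lerD2r.
  by rewrite (le_trans (normr_ln_le _ s0))// lerD// lef_pV2.
have dh1c s : c <= s <= T -> has_derive_in D h1 s (h2 s).
  by move=> /andP[cs sT]; apply: dh1; rewrite (lt_le_trans c0 cs).
have ctz : c <= t * z <= T by rewrite tzT andbT ler_pM2r//; lra.
have cyz : c <= y * z <= T by rewrite yzT andbT ler_pM2r// ltW.
have hl := has_derive_in_lipschitz _ _ _ _ _ _ cD dh1c h2c _ _ ctz cyz.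
rewrite /diff_quot /F1 -mulrBl mulrAC normrM [`|w z|]ger0_norm// ler_wpM2r//.
rewrite -mulrBr normrM normfV ler_pdivrMr ?normr_gt0 ?subr_eq0//.
rewrite normrM (gtr0_norm z0) (le_trans (ler_wpM2l (ltW z0) hl))//.
rewrite -mulrBl normrM (gtr0_norm z0) mulrCA -!mulrA ler_wpM2l//.
rewrite [`|y - t| * z]mulrC !mulrA ler_wpM2r//.
have -> : c^-1 = 2 / t / z by rewrite /c; field; rewrite !gt_eqF.
have t20 : 0 <= 2 / t by rewrite divr_ge0// ltW.
rewrite (_ : _ * z = z * (2 / t) + z ^+ 2 * (T + 1)); last first.
  by field; rewrite !gt_eqF.
rewrite -addrA lerD// ler_piMl//; first exact: ltW.
  by rewrite addr_ge0// ltW.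
by rewrite exprn_ile1// ltW.
Qed.

Let intF2 (t : R) : 0 < t <= T -> mu.-integrable I (EFin \o F2 t).
Proof.
move=> t0T; have Dt := D_of t t0T; have PFt := PF t Dt.
apply: (derivative_under_integral_integrable _ _ mu I D t F1 (F2 t)
  (fun z => K * (2 / t + T + 1) * w z)) => //.
- exact: leF1.
- by move=> z; exact: dF1.
Qed.

Lemma dilated_integral_derivatives : exists (g1 g2 : R -> R) (Q : R),
  [/\ 0 < Q,
    forall t, 0 <= t <= T ->
      has_derive_in D (fun t => \int[mu]_(z in I) (h (t * z) * w z)) t (g1 t) /\
      `|g1 t| <= Q &
    forall t, 0 < t <= T ->
      has_derive_in D g1 t (g2 t) /\ `|g2 t| <= Q * (`|ln t| + 1)].
Proof.
pose W := \int[mu]_(z in I) w z.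
have W0 : 0 <= W by apply: Rintegral_ge0.
exists (fun t => \int[mu]_(z in I) F1 t z), (fun t => \int[mu]_(z in I) F2 t z).
exists (3 * K * W + 1); split.
- by rewrite ltr_wpDl// !mulr_ge0.
- move=> t tT; have Dt : D t by rewrite /= in_itv.
  split.
    apply: (has_derive_in_Rintegral _ _ mu I D t F (F1 t) (fun z => K * w z)) => //.
    + exact: leF.
    + by move=> z; exact: dF.
  apply: (@le_trans _ _ (K * W)); last first.
    have : 0 <= K * W by rewrite mulr_ge0.
    by lra.
  apply: le_int; first exact: intF1.
  move=> z Iz; have := mulz_seg z Iz t Dt; rewrite /= in_itv/= => tz.
  move: Iz; rewrite /= in_itv/= => /andP[z0 z1].
  rewrite /F1 normrM [`|w z|]ger0_norm// ler_wpM2r// normrM (gtr0_norm z0).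
  by rewrite -[leRHS]mul1r ler_pM ?(ltW z0) ?(ltW z1) ?h1K.
- move=> t t0T; have Dt := D_of t t0T.
  split.
    apply: (has_derive_in_Rintegral _ _ mu I D t F1 (F2 t)
      (fun z => K * (2 / t + T + 1) * w z)) => //.
    + exact: leF1.
    + by move=> z; exact: dF1.
  have lnt0 := normr_ge0 (ln t).
  apply: (@le_trans _ _ (K * (`|ln t| + 3) * W)); last first.
    have : 0 <= K * W by rewrite mulr_ge0.
    by nra.
  apply: le_int; first exact: intF2.
  move=> z Iz; have := mulz_seg z Iz t Dt; rewrite /= in_itv/= => /andP[_ tzT].
  move: Iz t0T; rewrite /= in_itv/= => /andP[z0 z1] /andP[t0 tT].
  have tz0 : 0 < t * z by rewrite mulr_gt0.
  rewrite /F2 normrM [`|w z|]ger0_norm// ler_wpM2r// mulrA normrM.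
  rewrite ger0_norm ?mulr_ge0 ?(ltW z0)//.
  have hh : `|h2 (t * z)| <= K * (`|ln (t * z)| + 1) by rewrite h2K// tz0.
  have zz0 : 0 <= z * z by rewrite mulr_ge0 ?(ltW z0).
  rewrite (le_trans (ler_wpM2l zz0 hh))// mulrCA ler_wpM2l//.
  have lnz := mulr_normr_ln_le _ z0; have lnz0 := normr_ge0 (ln z).
  have : `|ln (t * z)| <= `|ln t| + `|ln z| by rewrite lnM ?posrE// ler_normD.
  move: `|ln (t * z)| `|ln t| `|ln z| lnz lnz0 lnt0 => L A B lnz lnz0 lnt0 LAB.
  have zz1 : z * z <= 1 by nra.
  have zzA : z * z * A <= A by rewrite ler_piMl.
  have zzB : z * (z * B) <= 2 by nra.
  have zzL : z * z * (L + 1) <= z * z * (A + B + 1) by rewrite ler_wpM2l// lerD2r.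
  by rewrite (le_trans zzL)//; lra.
Qed.

End dilated_integral.

(** * The variable power s^u(s) *)

Section self_power.
Context {R : realType}.
Variables (T M : R) (u u1 u2 G G1 G2 : R -> R).
Local Notation D := (`[0, T]%classic : set R).
Hypotheses (T0 : 0 < T) (M0 : 0 <= M).
Hypothesis du : forall s : R, 0 <= s <= T -> has_derive_in D u s (u1 s).
Hypothesis du1 : forall s : R, 0 <= s <= T -> has_derive_in D u1 s (u2 s).
Hypothesis dG : forall s : R, 0 <= s <= T -> has_derive_in D G s (G1 s).
Hypothesis dG1 : forall s : R, 0 <= s <= T -> has_derive_in D G1 s (G2 s).
Hypothesis uM : forall s : R, 0 <= s <= T -> `|u s| <= M * s ^+ 2.
Hypothesis u1M : forall s : R, 0 <= s <= T -> `|u1 s| <= M * s.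
Hypothesis u2M : forall s : R, 0 <= s <= T -> `|u2 s| <= M.
Hypothesis GM : forall s : R, 0 <= s <= T -> `|G s| <= M.
Hypothesis G1M : forall s : R, 0 <= s <= T -> `|G1 s| <= M.
Hypothesis G2M : forall s : R, 0 <= s <= T -> `|G2 s| <= M.

Let v s := u s * ln s.
(* At s = 0 the conventions ln 0 = 0 and 0^-1 = 0 give v1 0 = 0, the derivative
   of v there. *)
Let v1 s := u1 s * ln s + u s * s^-1.
Let v2 s := u2 s * ln s + u1 s * s^-1 + (u1 s * s^-1 + u s * (- s^-1 * s^-1)).

Let u00 : u 0 = 0.
Proof.
have := uM 0; rewrite lexx (ltW T0) expr0n mulr0 => /(_ isT).
by rewrite normr_le0 => /eqP.
Qed.

(* Also true at s = 0, since u 0 = 0 and 0 `^ 0 = 1. *)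
Let powRE s : 0 <= s -> s `^ (u s) = expR (v s).
Proof.
rewrite le_eqVlt => /predU1P[<-|s0]; last by rewrite /powR gt_eqF.
by rewrite /v u00 powRr0 mul0r expR0.
Qed.

Let has_derive_in_inv (s : R) : 0 < s ->
  has_derive_in D (fun y => y^-1) s (- s^-1 * s^-1).
Proof.
move=> s0; rewrite -[X in has_derive_in _ _ _ X]mulr1.
apply: (has_derive_inV _ id); first by rewrite gt_eqF.
exact: is_derive_has_derive_in.
Qed.

Let has_derive_in_ln (s : R) : 0 < s -> has_derive_in D (@ln R) s s^-1.
Proof. by move=> s0; apply: is_derive_has_derive_in; exact: is_derive1_ln. Qed.

(* y |ln y| = 2 y |ln (sqrt y)| <= 2 sqrt y (1 + y), which tends to 0. *)
Let dv_at0 : has_derive_in D v 0 0.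
Proof.
have s0 : (4 * M * (Num.sqrt y * (1 + y))) @[y --> within D 0^'] --> (0 : R).
  suff : (4 * M * (Num.sqrt y * (1 + y))) @[y --> within D 0^'] -->
      4 * M * (Num.sqrt 0 * (1 + 0)) by rewrite sqrtr0 mul0r mulr0.
  apply: cvgM; first exact: cvg_cst.
  apply: cvgM.
    exact: (cvg_comp _ _ (within_dnbhs_cvg _ _) (@sqrt_continuous R 0)).
  by apply: cvgD; [exact: cvg_cst|exact: within_dnbhs_cvg].
apply: norm_cvg0.
apply: (@squeeze_cvgr _ _ _ _ (cst 0) _ _ _ _ _ s0); last exact: cvg_cst.
rewrite near_withinE near_withinE; apply/nearW => y y0 /=.
rewrite in_itv/= => /andP[y0' yT]; have {y0 y0'}yp : 0 < y by rewrite lt_neqAle eq_sym y0.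
rewrite normr_ge0/= /diff_quot /v u00 mul0r !subr0.
rewrite !normrM normfV (gtr0_norm yp) ler_pdivrMr//.
set r := Num.sqrt y; have r0 : 0 < r by rewrite sqrtr_gt0.
have yE : y = r ^+ 2 by rewrite sqr_sqrtr// ltW.
have lny : `|ln y| = 2 * `|ln r|.
  by rewrite yE lnXn// normrMn mulr_natl.
have uy : `|u y| <= M * y ^+ 2 by rewrite uM// (ltW yp).
rewrite (le_trans (ler_wpM2r (normr_ge0 _) uy))// lny.
have rr : y * `|ln r| <= r * (1 + y).
  have := mulr_normr_ln_le _ r0; rewrite -yE => /(ler_wpM2l (ltW r0)).
  by rewrite mulrA -expr2 -yE.
have My : 0 <= M * y by rewrite mulr_ge0// ltW.
have := ler_wpM2l My rr.
have := mulr_ge0 My (mulr_ge0 (ltW r0) (addr_ge0 ler01 (ltW yp))).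
nra.
Qed.

Let dv (s : R) : 0 <= s <= T -> has_derive_in D v s (v1 s).
Proof.
move=> /andP[]; rewrite le_eqVlt => /predU1P[<- _|s0 sT].
  by rewrite /v1 ln0// u00 mulr0 mul0r addr0; exact: dv_at0.
apply: has_derive_inM; last exact: has_derive_in_ln.
by apply: du; rewrite sT ltW.
Qed.

Let dv1 (s : R) : 0 < s <= T -> has_derive_in D v1 s (v2 s).
Proof.
move=> /andP[s0 sT]; have s0T : 0 <= s <= T by rewrite ltW.
apply: has_derive_inD; apply: has_derive_inM.
- exact: du1.
- exact: has_derive_in_ln.
- exact: du.
- exact: has_derive_in_inv.
Qed.

Let v1_bounded : exists2 V, 0 <= V &
  forall s : R, 0 <= s <= T -> `|v1 s| <= V.
Proof.
have T0' := ltW T0; exists (M * (1 + T ^+ 2 + T)).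
  by rewrite ?(mulr_ge0, addr_ge0, exprn_ge0).
move=> s sT; have /andP[] := sT; rewrite le_eqVlt => /predU1P[<- _|s0 sT'].
  rewrite /v1 ln0// u00 mulr0 mul0r addr0 normr0.
  by rewrite ?(mulr_ge0, addr_ge0, exprn_ge0).
rewrite (le_trans (ler_normD _ _))// mulrDr; apply: lerD; rewrite normrM.
  rewrite (le_trans (ler_wpM2r (normr_ge0 _) (u1M s sT)))// -mulrA ler_wpM2l//.
  rewrite (le_trans (mulr_normr_ln_le _ s0))// lerD2l.
  by rewrite lerXn2r ?nnegrE// ltW.
rewrite (le_trans (ler_wpM2r (normr_ge0 _) (uM s sT)))// -mulrA ler_wpM2l//.
by rewrite gtr0_norm ?invr_gt0// expr2 mulfK ?gt_eqF.
Qed.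

Let v_le (s : R) : 0 <= s <= T -> `|v s| <= M * T * (1 + T ^+ 2).
Proof.
move=> sT; have /andP[] := sT; rewrite le_eqVlt => /predU1P[<- _|s0 sT'].
  have T0' := ltW T0; rewrite /v u00 mul0r normr0.
  by rewrite ?(mulr_ge0, addr_ge0, exprn_ge0).
rewrite normrM (le_trans (ler_wpM2r (normr_ge0 _) (uM s sT)))//.
rewrite expr2 -!mulrA ler_wpM2l//; have s0' := ltW s0.
apply: ler_pM => //; first exact: mulr_ge0.
by rewrite (le_trans (mulr_normr_ln_le _ s0))// lerD2l lerXn2r ?nnegrE// ltW.
Qed.

Let v2_le (s : R) : 0 < s <= T -> `|v2 s| <= 3 * M * (`|ln s| + 1).
Proof.
move=> /andP[s0 sT]; have s0T : 0 <= s <= T by rewrite ltW.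
have si : 0 <= s^-1 by rewrite invr_ge0 ltW.
have t1 : `|u2 s * ln s| <= M * `|ln s| by rewrite normrM ler_wpM2r ?u2M.
have t2 : `|u1 s * s^-1| <= M.
  rewrite normrM [X in _ * X]ger0_norm//.
  by rewrite (le_trans (ler_wpM2r si (u1M s s0T)))// mulfK ?gt_eqF.
have t3 : `|u s * (- s^-1 * s^-1)| <= M.
  rewrite normrM mulNr normrN [X in _ * X]ger0_norm ?mulr_ge0// mulrA.
  rewrite (le_trans (ler_wpM2r si (ler_wpM2r si (uM s s0T))))//.
  by rewrite expr2 mulrA !mulfK ?gt_eqF.
have t4 : 0 <= M * `|ln s| by rewrite mulr_ge0.
rewrite (le_trans (ler_normD _ _))// (le_trans (lerD (ler_normD _ _) (ler_normD _ _)))//.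
by lra.
Qed.

Let expR_v_bounded : exists2 X, 0 <= X &
  forall s : R, 0 <= s <= T -> `|expR (v s)| <= X.
Proof.
exists (expR (M * T * (1 + T ^+ 2))) => [|s sT]; first exact: expR_ge0.
rewrite ger0_norm ?expR_ge0// ler_expR.
by rewrite (le_trans (ler_norm _))// v_le.
Qed.

Lemma self_power_derivatives : exists (h1 h2 : R -> R) (K : R),
  (forall s : R, 0 <= s <= T ->
    has_derive_in D (fun s => s `^ u s * G s) s (h1 s) /\ `|h1 s| <= K) /\
  (forall s : R, 0 < s <= T ->
    has_derive_in D h1 s (h2 s) /\ `|h2 s| <= K * (`|ln s| + 1)).
Proof.
have [V V0 v1_le] := v1_bounded; have [X X0 X_ge] := expR_v_bounded.
have dE (s : R) : 0 <= s <= T -> has_derive_in D (expR \o v) s (expR (v s) * v1 s).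
  by move=> sT; apply: has_derive_in_comp; exact: dv.
pose h1 s := expR (v s) * v1 s * G s + expR (v s) * G1 s.
pose h2 s := (expR (v s) * v1 s * v1 s + expR (v s) * v2 s) * G s +
  expR (v s) * v1 s * G1 s + (expR (v s) * v1 s * G1 s + expR (v s) * G2 s).
pose K := X * (V * M + M) + X * (V * V * M + V * M + (V * M + M)) + X * (3 * M * M).
exists h1, h2, K; split=> s sT.
- split.
    apply: (@eq_has_derive_in _ _ (fun s => (expR \o v) s * G s)).
    + by rewrite /= in_itv.
    + move=> y; rewrite inE/= in_itv/= => /andP[y0 _].
      by rewrite powRE.
    + by apply: has_derive_inM; [exact: dE|exact: dG].
  have H1 : `|expR (v s) * v1 s * G s| <= X * V * M.
    by rewrite !normrM !ler_pM ?mulr_ge0 ?X_ge ?v1_le ?GM.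
  have H2 : `|expR (v s) * G1 s| <= X * M.
    by rewrite !normrM !ler_pM ?X_ge ?G1M.
  have H3 : 0 <= X * (V * V * M + V * M + (V * M + M)) + X * (3 * M * M).
    by rewrite ?(mulr_ge0, addr_ge0).
  rewrite (le_trans (ler_normD _ _))//; rewrite /K; lra.
- have sT' : 0 <= s <= T by case/andP: sT => s0 ->; rewrite ltW.
  split.
    apply: has_derive_inD; apply: has_derive_inM.
    + by apply: has_derive_inM; [exact: dE|exact: dv1].
    + exact: dG.
    + exact: dE.
    + exact: dG1.
  have L0 := normr_ge0 (ln s).
  have H1 : `|expR (v s) * v1 s * v1 s * G s| <= X * V * V * M.
    by rewrite !normrM !ler_pM ?mulr_ge0 ?X_ge ?v1_le ?GM.
  have H2 : `|expR (v s) * v2 s * G s| <= X * (3 * M * (`|ln s| + 1)) * M.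
    by rewrite !normrM !ler_pM ?mulr_ge0 ?X_ge ?v2_le ?GM.
  have H3 : `|expR (v s) * v1 s * G1 s| <= X * V * M.
    by rewrite !normrM !ler_pM ?mulr_ge0 ?X_ge ?v1_le ?G1M.
  have H4 : `|expR (v s) * G2 s| <= X * M.
    by rewrite !normrM !ler_pM ?X_ge ?G2M.
  have H5 : 0 <= X * (V * M + M) * (`|ln s| + 1).
    by rewrite ?(mulr_ge0, addr_ge0).
  have H6 : 0 <= X * (V * V * M + V * M + (V * M + M)) * `|ln s|.
    by rewrite ?(mulr_ge0, addr_ge0).
  rewrite /h2 mulrDl.
  rewrite (le_trans (ler_normD _ _))//.
  rewrite (le_trans (lerD (ler_normD _ _) (ler_normD _ _)))//.
  rewrite (le_trans (lerD (lerD (ler_normD _ _) (lexx _)) (lexx _)))//.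
  by rewrite /K; lra.
Qed.

End self_power.

Section reciprocal_gamma.
Context {R : realType}.
Variables (T C M : R) (a a1 a2 : R -> R).
Local Notation D := (`[0, T]%classic : set R).
Hypothesis a12 : forall s : R, 0 <= s <= T -> 1 < a s < 2.
Hypothesis da : forall s : R, 0 <= s <= T -> has_derive_in D a s (a1 s).
Hypothesis da1 : forall s : R, 0 <= s <= T -> has_derive_in D a1 s (a2 s).
Hypothesis a1M : forall s : R, 0 <= s <= T -> `|a1 s| <= M.
Hypothesis a2M : forall s : R, 0 <= s <= T -> `|a2 s| <= M.

Let g k s := gamma_derive k (2 - a s).

Let dg k (s : R) : 0 <= s <= T -> has_derive_in D (g k) s (- g k.+1 s * a1 s).
Proof.
move=> sT; have /andP[a1s as2] := a12 s sT.
apply: (has_derive_in_comp _ (fun y => gamma_derive k (2 - y)) a); last exact: da.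
have d1 : is_derive (a s) 1 (fun y : R => 2 - y) (-1).
  apply: (is_derive_eq (is_deriveB (is_derive_cst (2 : R) _ _) (is_derive_id _ _))).
  by rewrite sub0r.
have a02 : 0 < 2 - a s < 2 by apply/andP; split; lra.
have := @is_derive1_comp _ (gamma_derive k) (fun y => 2 - y) _ _ _
  (is_derive_gamma_derive k _ a02) d1.
by rewrite mulrN1.
Qed.

Let r s := (g 0 s)^-1.
Let r1 s := r s * r s * (g 1 s * a1 s).
Let r2 s := (r1 s * r s + r s * r1 s) * (g 1 s * a1 s) +
  r s * r s * ((- g 2 s * a1 s) * a1 s + g 1 s * a2 s).

Let dr (s : R) : 0 <= s <= T -> has_derive_in D r s (r1 s).
Proof.
move=> sT; have -> : r1 s = - r s * r s * (- g 1 s * a1 s) by rewrite /r1; ring.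
apply: has_derive_inV; last exact: dg.
have /andP[a1s as2] := a12 s sT.
by rewrite gt_eqF// gamma_derive0_gt0//; apply/andP; split; lra.
Qed.

Let dr1 (s : R) : 0 <= s <= T -> has_derive_in D r1 s (r2 s).
Proof.
move=> sT; apply: has_derive_inM; apply: has_derive_inM.
- exact: dr.
- exact: dr.
- exact: dg.
- exact: da1.
Qed.

Lemma reciprocal_gamma_derivatives : exists (G1 G2 : R -> R) (B : R), 0 <= B /\
  forall s : R, 0 <= s <= T ->
  [/\ has_derive_in D (fun s => C / Gamma (2 - a s)) s (G1 s),
    has_derive_in D G1 s (G2 s), `|C / Gamma (2 - a s)| <= B, `|G1 s| <= B &
    `|G2 s| <= B].
Proof.
have [Mr rM] := has_derive_in_bounded _ _ _ _ dr.
have [M1 g1M] := has_derive_in_bounded _ _ _ _ (dg 1).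
have [M2 g2M] := has_derive_in_bounded _ _ _ _ (dg 2).
pose B := `|Mr| + `|M1| + `|M2| + `|M|.
have Mr0 := normr_ge0 Mr; have M10 := normr_ge0 M1.
have M20 := normr_ge0 M2; have M0 := normr_ge0 M.
have B0 : 0 <= B by rewrite ?addr_ge0.
have rB (s : R) : 0 <= s <= T -> `|r s| <= B.
  by move=> /rM /le_trans; apply; rewrite (le_trans (ler_norm _))// /B; lra.
have g1B (s : R) : 0 <= s <= T -> `|g 1 s| <= B.
  by move=> /g1M /le_trans; apply; rewrite (le_trans (ler_norm _))// /B; lra.
have g2B (s : R) : 0 <= s <= T -> `|g 2 s| <= B.
  by move=> /g2M /le_trans; apply; rewrite (le_trans (ler_norm _))// /B; lra.
have a1B (s : R) : 0 <= s <= T -> `|a1 s| <= B.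
  by move=> /a1M /le_trans; apply; rewrite (le_trans (ler_norm _))// /B; lra.
have a2B (s : R) : 0 <= s <= T -> `|a2 s| <= B.
  by move=> /a2M /le_trans; apply; rewrite (le_trans (ler_norm _))// /B; lra.
move: B B0 rB g1B g2B a1B a2B => {}B B0 rB g1B g2B a1B a2B.
pose B1 := B * B * (B * B).
pose B2 := (B1 * B + B * B1) * (B * B) + B * B * (B * B * B + B * B).
have B10 : 0 <= B1 by rewrite ?mulr_ge0.
have B20 : 0 <= B2 by rewrite ?(mulr_ge0, addr_ge0).
have r1B (s : R) : 0 <= s <= T -> `|r1 s| <= B1.
  by move=> sT; rewrite !normrM !ler_pM ?mulr_ge0 ?rB ?g1B ?a1B.
have r2B (s : R) : 0 <= s <= T -> `|r2 s| <= B2.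
  move=> sT; rewrite (le_trans (ler_normD _ _))// lerD//.
    rewrite normrM ler_pM// ?normrM ?ler_pM ?g1B ?a1B//.
    by rewrite (le_trans (ler_normD _ _))// lerD// normrM ler_pM ?rB ?r1B.
  rewrite normrM ler_pM// ?normrM ?ler_pM ?rB//.
  rewrite (le_trans (ler_normD _ _))// lerD// ?normrM ?normrN ?ler_pM ?mulr_ge0//;
  by rewrite ?g1B ?g2B ?a1B ?a2B.
exists (fun s => C * r1 s), (fun s => C * r2 s), (`|C| * (B + B1 + B2)); split.
  by rewrite ?(mulr_ge0, addr_ge0).
move=> s sT; rewrite GammaE; split.
- by apply: (has_derive_inZ _ _ r); exact: dr.
- by apply: has_derive_inZ; exact: dr1.
- by rewrite normrM ler_wpM2l// (le_trans (rB s sT))//; lra.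
- by rewrite normrM ler_wpM2l// (le_trans (r1B s sT))//; lra.
- by rewrite normrM ler_wpM2l// (le_trans (r2B s sT))//; lra.
Qed.

End reciprocal_gamma.

Theorem lemma3p1 (R : realType) (T : R) (alpha : R -> R)
  (hT : 0 < T)
  (halpha : forall t : R, 0 <= t <= T -> 1 < alpha t < 2)
  (hdiff : forall (n : nat) (t : R), (n < 3)%N -> 0 <= t <= T ->
     derivable_in `[0, T]%classic (derive_in_n `[0, T]%classic n alpha) t)
  (hbound : exists M : R, forall t : R, 0 <= t <= T ->
     `|derive_in_n `[0, T]%classic 1 alpha t|
     + `|derive_in_n `[0, T]%classic 2 alpha t|
     + `|derive_in_n `[0, T]%classic 3 alpha t| <= M)
  (halpha'0 : derive_in_n `[0, T]%classic 1 alpha 0 = 0) :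
  exists Q : R,
    [/\ 0 < Q,
        forall t : R, 0 <= t <= T ->
          derivable_in `[0, T]%classic (gen_identity alpha) t /\
          `|derive_in_n `[0, T]%classic 1 (gen_identity alpha) t| <= Q
      & forall t : R, 0 < t <= T ->
          derivable_in `[0, T]%classic
            (derive_in_n `[0, T]%classic 1 (gen_identity alpha)) t /\
          `|derive_in_n `[0, T]%classic 2 (gen_identity alpha) t|
            <= Q * (`|ln t| + 1)].
Proof.
pose D := `[0, T]%classic : set R.
pose a1 := derive_in_n D 1 alpha.
pose a2 := derive_in_n D 2 alpha.
have da (s : R) : 0 <= s <= T -> has_derive_in D alpha s (a1 s) by exact: hdiff 0%N s isT.
have da1 (s : R) : 0 <= s <= T -> has_derive_in D a1 s (a2 s) by exact: hdiff 1%N s isT.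
have [M HM] := hbound.
have D0 : (0 : R) <= 0 <= T by rewrite lexx ltW.
have a1M (s : R) : 0 <= s <= T -> `|a1 s| <= M.
  move=> sT; have := HM s sT; rewrite -/D -/(a1 s) -/(a2 s).
  have := normr_ge0 (a2 s); have := normr_ge0 (derive_in_n D 3 alpha s); lra.
have a2M (s : R) : 0 <= s <= T -> `|a2 s| <= M.
  move=> sT; have := HM s sT; rewrite -/D -/(a1 s) -/(a2 s).
  have := normr_ge0 (a1 s); have := normr_ge0 (derive_in_n D 3 alpha s); lra.
have M0 : 0 <= M by rewrite (le_trans _ (a1M 0 D0)).
have a1s (s : R) : 0 <= s <= T -> `|a1 s| <= M * s.
  move=> sT; have := has_derive_in_lipschitz _ _ _ _ _ _ (@subset_refl _ D)
    da1 a2M 0 s D0 sT.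
  by rewrite {2}/a1 halpha'0 !subr0 [`|s|]ger0_norm//; case/andP: sT.
pose u s := alpha 0 - alpha s.
have us (s : R) : 0 <= s <= T -> `|u s| <= M * s ^+ 2.
  move=> /andP[s0 sT].
  have sD : `[0, s]%classic `<=` D.
    by move=> x; rewrite /D /= !in_itv/= => /andP[-> xs]; rewrite (le_trans xs).
  have das (x : R) : 0 <= x <= s -> has_derive_in D alpha x (a1 x).
    by move=> /andP[x0 xs]; apply: da; rewrite x0 (le_trans xs).
  have a1ms (x : R) : 0 <= x <= s -> `|a1 x| <= M * s.
    move=> /andP[x0 xs]; rewrite (le_trans (a1s x _)) ?x0 ?(le_trans xs)//.
    by rewrite ler_wpM2l.
  have s00 : (0 : R) <= 0 <= s by rewrite lexx.
  have s0s : 0 <= s <= s by rewrite lexx s0.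
  have := has_derive_in_lipschitz _ _ _ _ _ _ sD das a1ms 0 s s00 s0s.
  by rewrite subr0 (ger0_norm s0) distrC expr2 mulrA.
have dN (f : R -> R) (x l : R) : has_derive_in D f x l ->
    has_derive_in D (fun s => - f s) x (- l).
  move=> /(has_derive_inZ _ (-1)); rewrite mulN1r.
  by congr (has_derive_in _ _ _ _); apply/funext => s; rewrite mulN1r.
have du (s : R) : 0 <= s <= T -> has_derive_in D u s (- a1 s).
  move=> sT; rewrite -[X in has_derive_in _ _ _ X]add0r; apply: has_derive_inD.
    exact: has_derive_in_cst.
  by apply: dN; exact: da.
have du1 (s : R) : 0 <= s <= T -> has_derive_in D (fun s => - a1 s) s (- a2 s).
  by move=> sT; apply: dN; exact: da1.
have [G1 [G2 [B [B0 HG]]]] :=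
  reciprocal_gamma_derivatives T (Gamma (alpha 0 - 1))^-1 M alpha a1 a2
    halpha da da1 a1M a2M.
pose G s := (Gamma (alpha 0 - 1))^-1 / Gamma (2 - alpha s).
pose N := M + B.
have [h1 [h2 [K [hh1 hh2]]]] : exists (h1 h2 : R -> R) (K : R),
  (forall s : R, 0 <= s <= T ->
    has_derive_in D (fun s => s `^ u s * G s) s (h1 s) /\ `|h1 s| <= K) /\
  (forall s : R, 0 < s <= T ->
    has_derive_in D h1 s (h2 s) /\ `|h2 s| <= K * (`|ln s| + 1)).
  have MN : M <= N by rewrite lerDl.
  have BN : B <= N by rewrite lerDr.
  apply: (self_power_derivatives T N u (fun s => - a1 s) (fun s => - a2 s) G G1 G2) => //.
  - exact: le_trans MN.
  - by move=> s /HG[].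
  - by move=> s /HG[].
  - by move=> s sT; rewrite (le_trans (us s sT))// ler_wpM2r// exprn_ge0; case/andP: sT.
  - move=> s sT; rewrite normrN (le_trans (a1s s sT))// ler_wpM2r//.
    by case/andP: sT.
  - by move=> s sT; rewrite normrN (le_trans (a2M s sT)).
  - by move=> s /HG[_ _ GB _ _]; exact: le_trans BN.
  - by move=> s /HG[_ _ _ GB _]; exact: le_trans BN.
  - by move=> s /HG[_ _ _ _ GB]; exact: le_trans BN.
pose h s := s `^ u s * G s.
pose w (z : R) := (1 - z) `^ (alpha 0 - 2) * z `^ (1 - alpha 0).
have w0 (z : R) : 0 <= w z by rewrite mulr_ge0 ?powR_ge0.
have /andP[al1 al2] := halpha 0 D0.
have intw : (@lebesgue_measure R).-integrable `]0, 1[ (EFin \o w).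
  by apply: integrable_powR_onem_powR; apply/andP; split; lra.
have dh (s : R) : 0 <= s <= T -> has_derive_in D h s (h1 s) by move=> /hh1[].
have h1K (s : R) : 0 <= s <= T -> `|h1 s| <= K by move=> /hh1[].
have dh1 (s : R) : 0 < s <= T -> has_derive_in D h1 s (h2 s) by move=> /hh2[].
have h2K (s : R) : 0 < s <= T -> `|h2 s| <= K * (`|ln s| + 1) by move=> /hh2[].
have [g1 [g2 [Q [Q0 gQ1 gQ2]]]] :=
  dilated_integral_derivatives T K h h1 h2 w hT w0 intw dh h1K dh1 h2K.
have gE : {in D, (fun t => \int[@lebesgue_measure R]_(z in `]0, 1[) (h (t * z) * w z)) =1
    gen_identity alpha}.
  move=> t; rewrite inE => Dt.
  have intF := integrable_dilation T K h h1 w hT intw dh h1K t Dt.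
  have -> : gen_identity alpha t =
      \int[@lebesgue_measure R]_(z in `[0, 1]) (h (t * z) * w z).
    apply: eq_Rintegral => z _; rewrite /h /G /w invfM.
    by rewrite !mulrA.
  by rewrite /Rintegral [in RHS]integral_itv_bndoo//; case/integrableP: intF.
have dg (t : R) : 0 <= t <= T ->
    derivable_in D (gen_identity alpha) t /\ derive_in D (gen_identity alpha) t = g1 t.
  move=> tT; apply: has_derive_inE => //.
  have [dg1 _] := gQ1 t tT; apply: eq_has_derive_in gE dg1.
  by rewrite /D /= in_itv.
exists Q; split=> // t tT.
  have [dgt e1] := dg t tT; split=> //.
  by rewrite /derive_in_n/= e1; have [] := gQ1 t tT.
have tT' : 0 <= t <= T by case/andP: tT => /ltW ->.
have [] := @has_derive_inE _ 0 T t (g2 t) (derive_in D (gen_identity alpha)) hT tT'.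
  have [dg2 _] := gQ2 t tT; apply: eq_has_derive_in dg2.
    by rewrite /D /= in_itv.
  by move=> s; rewrite inE /D /= in_itv/= => /dg[].
move=> dgt e2; split=> //.
by rewrite /derive_in_n/= e2; have [] := gQ2 t tT.
Qed.
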